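(* Let $A=(a_1,a_2,a_3,a_4)\in (L_\infty(G;\mathbb{H}_{\mathbb{C}}))^4$ and let $\mathbf{P}_G^A$ be the orthogonal projection of $L_2(G;\mathbb{H}_{\mathbb{C}})$ onto its closed subspace $\mathfrak{V}_A^2(G;\mathbb{H}_{\mathbb{C}})$. Then $$\mathbf{P}_G^Au(x)=\int_G\mathscr{K}_G^A(x,t;u(t))\,dV_t\qquad\text{for all } u\in L_2(G;\mathbb{H}_{\mathbb{C}}),\ x\in G,$$ where $\mathscr{K}_G^A$ is the Vekua-Bergman kernel of $\mathfrak{V}_A^2(G;\mathbb{H}_{\mathbb{C}})$.
   Context: Biquaternions: $\mathbb{H}_{\mathbb{C}}$ is the complex algebra of elements $p=p_0+\vec p$, $\vec p=\sum_{k=1}^3 p_ke_k$, $p_0,\dots,p_3\in\mathbb{C}$ (with $e_0=1$), with product $pq=p_0q_0+p_0\vec q+q_0\vec p-\vec p\cdot\vec q+\vec p\times\vec q$ (bilinear dot and cross products on $\mathbb{C}^3$, so $e_k^2=-1$ for $k=1,2,3$). Quaternionic conjugate: $\overline{p}=p_0-\vec p$. Inner product (conjugate-linear in the first slot): $\langle p,q\rangle_{\mathbb{H}_{\mathbb{C}}}=\sum_{k=0}^3p_k^*q_k$, $^*$ being complex conjugation. Domain: $G\subset\mathbb{R}^3$ is a bounded domain whose boundary $\Gamma$ is a Liapunov surface (in particular a $C^1$ surface with Hölder continuous unit normal), with $\mathbb{R}^3\setminus\overline{G}$ connected. Function spaces: a function $u=\sum_{k=0}^3u_ke_k:G\to\mathbb{H}_{\mathbb{C}}$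 belongs to $\mathscr{F}(G;\mathbb{H}_{\mathbb{C}})$ if each $u_k\in\mathscr{F}(G)$ (complex-valued space). $L_2(G;\mathbb{H}_{\mathbb{C}})$ is the complex Hilbert space with $\langle u,v\rangle_{L_2(G;\mathbb{H}_{\mathbb{C}})}=\int_G\langle u(x),v(x)\rangle_{\mathbb{H}_{\mathbb{C}}}dV_x$. Operators: $\mathbf{D}=\sum_{k=1}^3e_k\frac{\partial}{\partial x_k}$ (acting from the left). A function $v\in L_{1,loc}(G;\mathbb{H}_{\mathbb{C}})$ is the weak $\mathbf{D}$-derivative of $u\in L_{1,loc}(G;\mathbb{H}_{\mathbb{C}})$, written $v=\mathbf{D}u$, if $\int_G\overline{u}(\mathbf{D}\varphi)=\int_G\overline{v}\varphi$ for all $\varphi\in C_0^\infty(G;\mathbb{H}_{\mathbb{C}})$. For $A=(a_1,a_2,a_3,a_4)\in(L_\infty(G;\mathbb{H}_{\mathbb{C}}))^4$, $\mathbf{Q}_Aw=wa_1+\overline{w}a_2+a_3w+a_4\overline{w}$. $\mathfrak{V}_A^2(G;\mathbb{H}_{\mathbb{C}})$ is the set of weak solutions $w\in L_2(G;\mathbb{H}_{\mathbb{C}})$ of $\mathbf{D}w-\mathbf{Q}_Aw=0$ in $G$, i.e. those $w\in L_2(G;\mathbb{H}_{\mathbb{C}})$ having a weak $\mathbf{D}$-derivative equal to $\mathbf{Q}_Aw$. It is a closed complex subspace of $L_2(G;\mathbb{H}_{\mathbb{C}})$, its elements have continuous representatives on $G$ (used for point values), and for each $x\in G$ the functionals $w\mapsto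 w_k(x)\in\mathbb{C}$, $k=0,1,2,3$, are bounded on it in the $L_2$-norm. Kernel: for $x\in G$ and $k\in\{0,1,2,3\}$, $K_x^k\in\mathfrak{V}_A^2(G;\mathbb{H}_{\mathbb{C}})$ is the unique element (Riesz representation) with $w_k(x)=\langle K_x^k,w\rangle_{L_2(G;\mathbb{H}_{\mathbb{C}})}$ for all $w\in\mathfrak{V}_A^2(G;\mathbb{H}_{\mathbb{C}})$. The Vekua-Bergman kernel with coefficient $a=\sum_{j=0}^3a_je_j\in\mathbb{H}_{\mathbb{C}}$ (here $a_j\in\mathbb{C}$) is $\mathscr{K}_G^A(x,t;a)=\sum_{j=0}^3K_t^j(x)a_j$, $x,t\in G$. *)

(* Defs.v *)
From HB Require Import structures.
From mathcomp Require Import all_boot all_order all_algebra.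
From mathcomp Require Import complex.
From mathcomp Require Import all_classical all_reals all_analysis.

Set Implicit Arguments.
Unset Strict Implicit.
Unset Printing Implicit Defensive.
Import Order.TTheory GRing.Theory Num.Theory numFieldNormedType.Exports.
Local Open Scope classical_set_scope.
Local Open Scope ring_scope.
Local Open Scope complex_scope.

(* 'Re and 'Im of Num.Theory land in R[i]; these land in R. *)
Notation reC := complex.Re.
Notation imC := complex.Im.
Notation normC := ComplexField.Normc.normc.

(** * Euclidean space R^3 *)

Notation R3 R := (R * R * R)%type.

(* R3 R with the sigma-algebra on which the product Lebesgue measure lives;
   it is the Borel sigma-algebra, but with a measure display that differs
   from the one inferred by default on R * R * R. *)
Definition R3m (R : realType) : measurableType _ :=
  (measurableTypeR R * measurableTypeR R * measurableTypeR R)%type.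

Definition leb3 {R : realType} : {measure set (R3m R) -> \bar R} :=
  ((@lebesgue_measure R \x @lebesgue_measure R) \x @lebesgue_measure R)%E.

Section Space.
Context {R : realType}.
Implicit Types (x y : R3 R) (U S G : set (R3 R)) (f g : R3 R -> R).

Definition dot3 x y : R := x.1.1 * y.1.1 + x.1.2 * y.1.2 + x.2 * y.2.

(* The library norm on a product is the sup norm; this one is Euclidean. *)
Definition norm3 x : R := Num.sqrt (dot3 x x).

Definition basis3 (k : 'I_3) : R3 R :=
  ((k == 0 :> nat)%:R, (k == 1%N :> nat)%:R, (k == 2%N :> nat)%:R).

Definition partial (k : 'I_3) f x : R := 'D_(basis3 k) f x.

Definition grad f x : R3 R := (partial 0 f x, partial 1 f x, partial 2 f x).

(* f is of class C^n on the open set U. *)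
Fixpoint classC U (n : nat) f : Prop :=
  (forall x, U x -> {for x, continuous f}) /\
  match n with
  | 0 => True
  | m.+1 => forall k : 'I_3,
      (forall x, U x -> derivable f x (basis3 k)) /\ classC U m (partial k f)
  end.

Definition boundary G : set (R3 R) := closure G `\` G°.

(* S is a C^1 surface with unit normal field n: near each of its points S is
   a regular level set, whose gradient is parallel to n. *)
Definition C1_surface S (n : R3 R -> R3 R) : Prop :=
  forall p, S p -> norm3 (n p) = 1 /\
    exists U g, [/\ open U, U p, classC U 1 g,
      S `&` U = [set q | U q /\ g q = 0] &
      forall q, S q -> U q -> exists2 c : R, c != 0 & grad g q = c *: n q].

(* The three classical conditions on a closed bounded surface: existence of
   the normal, existence of a radius d such that inside a ball of radius d
   about p in S every line parallel to the normal at p meets S at most once,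
   and Hoelder continuity of the normal. *)
Definition liapunov_surface S : Prop :=
  compact S /\ exists n : R3 R -> R3 R,
  [/\ C1_surface S n,
      exists2 d : R, 0 < d & forall p q q', S p -> S q -> S q' ->
        norm3 (q - p) < d -> norm3 (q' - p) < d ->
        (exists s : R, q' - q = s *: n p) -> q = q' &
      exists L alpha : R, [/\ 0 < L, 0 < alpha <= 1 &
        forall p q, S p -> S q ->
          norm3 (n p - n q) <= L * norm3 (p - q) `^ alpha]].

Definition liapunov_domain G : Prop :=
  [/\ [/\ G !=set0, open G & connected G], bounded_set G,
      liapunov_surface (boundary G) & connected (~` closure G)].

End Space.

(** * Biquaternions *)

(* p is the row (p_0, p_1, p_2, p_3); the component p_k is p 0 k. *)
Notation HC R := 'rV[R[i]]_4.

Section Biquaternions.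
Context {R : realType}.
Implicit Types p q : HC R.

Definition bq (a b c d : R[i]) : HC R := \row_(k < 4) nth 0 [:: a; b; c; d] k.

Definition bqe (k : 'I_4) : HC R := delta_mx 0 k.

(* p_0 q_0 - p.q + p_0 q + q_0 p + p x q, written out by components *)
Definition bqmul p q : HC R :=
  bq (p 0 0 * q 0 0 - (p 0 1 * q 0 1 + p 0 2 * q 0 2 + p 0 3 * q 0 3))
     (p 0 0 * q 0 1 + q 0 0 * p 0 1 + (p 0 2 * q 0 3 - p 0 3 * q 0 2))
     (p 0 0 * q 0 2 + q 0 0 * p 0 2 + (p 0 3 * q 0 1 - p 0 1 * q 0 3))
     (p 0 0 * q 0 3 + q 0 0 * p 0 3 + (p 0 1 * q 0 2 - p 0 2 * q 0 1)).

(* Quaternionic, not complex, conjugation. *)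
Definition bqconj p : HC R := bq (p 0 0) (- p 0 1) (- p 0 2) (- p 0 3).

Definition bqdot p q : R[i] := \sum_(k < 4) conjc (p 0 k) * q 0 k.

End Biquaternions.

Local Notation "p *q q" := (bqmul p q) (at level 40, left associativity).

(** * Function spaces on G

    Functions are total on R^3 and only their values on G matter; elements of
    the Lebesgue spaces are represented by functions, not by a.e. classes. *)

Section FunctionSpaces.
Context {R : realType}.
Variable G : set (R3 R).
Implicit Types (f : R3 R -> R[i]) (u v w phi : R3 R -> HC R).

Definition cintegrable f : Prop :=
  leb3.-integrable G (fun x => (reC (f x))%:E) /\
  leb3.-integrable G (fun x => (imC (f x))%:E).

Definition cintegral f : R[i] :=
  (\int[leb3]_(x in G) reC (f x)) +i* (\int[leb3]_(x in G) imC (f x)).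

Definition cmeasurable f : Prop :=
  @measurable_fun _ _ (R3m R) R G (fun x => reC (f x)) /\
  @measurable_fun _ _ (R3m R) R G (fun x => imC (f x)).

Definition ccontinuous f : Prop :=
  forall x, G x -> {for x, continuous (fun y => reC (f y))} /\
                   {for x, continuous (fun y => imC (f y))}.

Definition cL2 f : Prop :=
  cmeasurable f /\ (\int[leb3]_(x in G) (normC (f x) ^+ 2)%:E < +oo)%E.

Definition cLinfty f : Prop :=
  cmeasurable f /\ exists M : R, {ae leb3, forall x, G x -> normC (f x) <= M}.

(* F(G; H_C) for a space F(G) of complex-valued functions *)
Definition bqspace (F : (R3 R -> R[i]) -> Prop) u : Prop :=
  forall k : 'I_4, F (fun x => u x 0 k).

Definition bqintegrable u : Prop := bqspace cintegrable u.

Definition bqintegral u : HC R := \row_(k < 4) cintegral (fun x => u x 0 k).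

Definition bqcontinuous u : Prop := bqspace ccontinuous u.

Definition bqL2 u : Prop := bqspace cL2 u.

Definition bqLinfty u : Prop := bqspace cLinfty u.

Definition L2dot u v : R[i] := cintegral (fun x => bqdot (u x) (v x)).

(* C_0^oo(G; H_C) *)
Definition test_function phi : Prop :=
  (forall (k : 'I_4) (n : nat),
     classC [set: R3 R] n (fun x => reC (phi x 0 k)) /\
     classC [set: R3 R] n (fun x => imC (phi x 0 k))) /\
  exists C : set (R3 R),
    [/\ compact C, C `<=` G & forall x, ~ C x -> phi x = 0].

(* v is the continuous representative of w, the one used for point values. *)
Definition continuous_rep w v : Prop :=
  bqcontinuous v /\ {ae leb3, forall x, G x -> v x = w x}.

(* P is an orthogonal projection of L_2(G; H_C) onto the subspace V. *)
Definition orthogonal_projection (V : set (R3 R -> HC R))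
    (P : (R3 R -> HC R) -> (R3 R -> HC R)) : Prop :=
  forall u, bqL2 u ->
    V (P u) /\ forall v, V v -> L2dot v (fun x => u x - P u x) = 0.

End FunctionSpaces.

Section Equation.
Context {R : realType}.
Variable G : set (R3 R).
Implicit Types (u v w phi : R3 R -> HC R).

Definition cL1loc (f : R3 R -> R[i]) : Prop :=
  cmeasurable G f /\
  forall C : set (R3 R), compact C -> C `<=` G -> cintegrable C f.

Definition bqL1loc u : Prop := bqspace cL1loc u.

Definition bqpartial (k : 'I_3) u (x : R3 R) : HC R :=
  \row_(j < 4) (partial k (fun y => reC (u y 0 j)) x +i*
                partial k (fun y => imC (u y 0 j)) x).

(* The k-th coordinate of R^3, 0 <= k < 3, goes with the unit e_(k+1). *)
Definition diracD u (x : R3 R) : HC R :=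
  \sum_(k < 3) bqe (lift ord0 k) *q bqpartial k u x.

Definition weakD u v : Prop :=
  [/\ bqL1loc u, bqL1loc v & forall phi, test_function G phi ->
    bqintegral G (fun x => bqconj (u x) *q diracD phi x) =
    bqintegral G (fun x => bqconj (v x) *q phi x)].

Definition coefficients : Type :=
  ((R3 R -> HC R) * (R3 R -> HC R) * (R3 R -> HC R) * (R3 R -> HC R))%type.

Definition Linfty4 (A : coefficients) : Prop :=
  let: (a1, a2, a3, a4) := A in
  [/\ bqLinfty G a1, bqLinfty G a2, bqLinfty G a3 & bqLinfty G a4].

Definition QA (A : coefficients) w (x : R3 R) : HC R :=
  let: (a1, a2, a3, a4) := A in
  w x *q a1 x + bqconj (w x) *q a2 x + a3 x *q w x + a4 x *q bqconj (w x).

Definition vekua2 (A : coefficients) : set (R3 R -> HC R) :=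
  [set w | bqL2 G w /\ weakD w (QA A w)].

(* K x k stands for K_x^k, taken as its continuous representative because
   its point values enter vekua_bergman below. *)
Definition reproducing_kernel (A : coefficients)
    (K : R3 R -> 'I_4 -> R3 R -> HC R) : Prop :=
  forall (x : R3 R) (k : 'I_4), G x ->
    [/\ vekua2 A (K x k), bqcontinuous G (K x k) &
        forall w v, vekua2 A w -> continuous_rep G w v ->
          v x 0 k = L2dot G (K x k) w].

End Equation.

Definition vekua_bergman {R : realType} (K : R3 R -> 'I_4 -> R3 R -> HC R)
    (x t : R3 R) (a : HC R) : HC R :=
  \sum_(j < 4) a 0 j *: K t j x.

(* Main.v *)
(** Orthogonality of [u - P u] to [K_x^k] turns the reproducing identity
    [(P u)_k(x) = <K_x^k, P u>] into [(P u)_k(x) = <K_x^k, u>]. Applying the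
    reproducing identity to the kernels themselves gives the Hermitian symmetry
    [(K_t^j)_k(x) = ((K_x^k)_j(t))^*], so the [k]-th component of
    [sum_j K_t^j(x) u_j(t)] is the integrand of [<K_x^k, u>]. *)

Require Import Defs.
From HB Require Import structures.
From mathcomp Require Import all_boot all_order all_algebra.
From mathcomp Require Import complex.
From mathcomp Require Import all_classical all_reals all_analysis.
From mathcomp Require Import measurable_realfun ring lra.
Set Implicit Arguments.
Unset Strict Implicit.
Unset Printing Implicit Defensive.
Import Order.TTheory GRing.Theory Num.Theory numFieldNormedType.Exports.
Local Open Scope ring_scope.
Local Open Scope classical_set_scope.

(** An open set is the union of the balls it contains with rational centre and radius [1/(n+1)], and
    these are countably many. This makes the open domain [G] measurable for the product
    sigma-algebra that carries [leb3]. *)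
Lemma measurable_open_R3 (R : realType) (U : set (R3 R)) :
  open U -> measurable (U : set (R3m R)).
Proof.
move=> oU.
pose B (i : rat * rat * rat * nat) : set (R3 R) :=
  ball ((ratr i.1.1.1, ratr i.1.1.2, ratr i.1.2) : R3 R) i.2.+1%:R^-1.
(* Sending the balls not inside [U] to [set0] keeps the whole countable type as index set. *)
have -> : U = \bigcup_i (if `[< B i `<=` U >] then B i else set0).
  apply/seteqP; split=> [x Ux|x [i _]]; last by case: asboolP => // + Bx; exact.
  have /nbhs_ballP[e /= e0 xeU] : nbhs x U by exact: open_nbhs_nbhs.
  (* Half of [e] suffices: if the centre is within [d] of [x], the ball of radius [d] lies within
     [d + d <= e] of [x]. *)
  have [n ne] : exists n, n.+1%:R^-1 < e / 2.
    have e20 : 0 < e / 2 by rewrite divr_gt0.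
    have [n _ /(_ n (leqnn n))] := near_infty_natSinv_lt (PosNum e20).
    by exists n.
  pose d : R := n.+1%:R^-1.
  have d0 : 0 < d by rewrite invr_gt0.
  have q (y : R) : exists q : rat, `|ratr q - y| < d.
    have [|q] := @rat_in_itvoo R (y - d) (y + d); first lra.
    rewrite in_itv/= => /andP[? ?]; exists q.
    by rewrite ltr_norml; apply/andP; split; lra.
  have [q1 h1] := q x.1.1; have [q2 h2] := q x.1.2; have [q3 h3] := q x.2.
  have Bx : B (q1, q2, q3, n) x by [].
  exists (q1, q2, q3, n) => //; case: asboolP => // -[] y By; apply: xeU.
  apply: (@le_ball _ _ _ (d + d)); first by rewrite [e]splitr lerD// ltW.
  exact: ball_triangle (ball_sym Bx) By.
apply: countable_bigcupT_measurable => [|i]; first exact: countableP.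
case: ifPn => // _.
have mb (y r : R) : measurable (ball y r : set (measurableTypeR R)).
  by rewrite ball_itv; exact: measurable_itv.
(* Balls of the sup norm are products of three intervals. *)
exact: measurableX (measurableX (mb _ _) (mb _ _)) (mb _ _).
Qed.

(** Expanding the squares of [a - c], [b - d], [a + c] and [b + d] gives both signs. The bound
    serves to dominate the real and imaginary parts of a product by squared moduli. *)
Lemma normr_mulD_le (R : realDomainType) (a b c d : R) :
  `|a * c + b * d| <= a ^+ 2 + b ^+ 2 + (c ^+ 2 + d ^+ 2).
Proof.
have := sqr_ge0 a; have := sqr_ge0 b; have := sqr_ge0 c; have := sqr_ge0 d.
have := sqr_ge0 (a - c); have := sqr_ge0 (b - d).
have := sqr_ge0 (a + c); have := sqr_ge0 (b + d).
by rewrite ler_norml !expr2 => *; apply/andP; split; lra.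
Qed.

Section ComplexIntegral.
Context {R : realType}.
Variable G : set (R3 R).
Hypothesis mG : measurable (G : set (R3m R)).
Implicit Types f g : R3 R -> R[i].

Lemma normC_sqr (z : R[i]) : normC z ^+ 2 = reC z ^+ 2 + imC z ^+ 2.
Proof. by case: z => a b /=; rewrite sqr_sqrtr// addr_ge0 ?sqr_ge0. Qed.

Lemma cL2_integrable f : cL2 G f ->
  leb3.-integrable G (fun x => (normC (f x) ^+ 2)%:E).
Proof.
move=> [[mr mi] foo]; apply/integrableP; split.
  apply/measurable_EFinP; under eq_fun do rewrite normC_sqr.
  by apply: measurable_funD; apply: measurable_funX.
by under eq_integral do rewrite gee0_abs ?lee_fin ?sqr_ge0//.
Qed.

(** Both parts of the product are dominated by the integrable function [|f|^2 + |g|^2], so no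
    Hoelder inequality is called on. *)
Lemma cintegrable_conjM f g : cL2 G f -> cL2 G g ->
  cintegrable G (fun x => conjc (f x) * g x).
Proof.
move=> f2 g2.
have ifg := integrableD mG (cL2_integrable f2) (cL2_integrable g2).
have [[[mfr mfi] _] [[mgr mgi] _]] := (f2, g2).
split; apply: le_integrable ifg => //=.
- apply/measurable_EFinP.
  rewrite (_ : (fun _ => _) = (fun x =>
    reC (f x) * reC (g x) + imC (f x) * imC (g x))); last first.
    by apply/funext => x; case: (f x) (g x) => a b [c d] /=; ring.
  by apply: measurable_funD; apply: measurable_funM.
- move=> x _; rewrite lee_fin !normC_sqr.
  rewrite [leRHS]ger0_norm ?addr_ge0 ?sqr_ge0//.
  case: (f x) (g x) => a b [c d] /=.
  by rewrite mulNr opprK; exact: normr_mulD_le.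
- apply/measurable_EFinP.
  rewrite (_ : (fun _ => _) = (fun x =>
    reC (f x) * imC (g x) - imC (f x) * reC (g x))); last first.
    by apply/funext => x; case: (f x) (g x) => a b [c d] /=; ring.
  by apply: measurable_funB; apply: measurable_funM.
- move=> x _; rewrite lee_fin !normC_sqr.
  rewrite [leRHS]ger0_norm ?addr_ge0 ?sqr_ge0//.
  case: (f x) (g x) => a b [c d] /=.
  (* The imaginary part is [a * d - b * c], hence the sign on [b] and the swap of [c] and [d]. *)
  by have := normr_mulD_le a (- b) d c; rewrite sqrrN (addrC (d ^+ 2)).
Qed.

Lemma cintegrableD f g : cintegrable G f -> cintegrable G g ->
  cintegrable G (fun x => f x + g x).
Proof.
move=> [fr fi] [gr gi]; split.
  apply: eq_integrable (integrableD mG fr gr) => // x _ /=.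
  by rewrite -EFinD; case: (f x) (g x) => ? ? [].
apply: eq_integrable (integrableD mG fi gi) => // x _ /=.
by rewrite -EFinD; case: (f x) (g x) => ? ? [].
Qed.

Lemma cintegrable_sum (I : Type) (s : seq I) (F : I -> R3 R -> R[i]) :
  (forall i, cintegrable G (F i)) ->
  cintegrable G (fun x => \sum_(i <- s) F i x).
Proof.
move=> iF; elim: s => [|i s IHs].
  by under eq_fun do rewrite big_nil; split; exact: integrable0.
by under eq_fun do rewrite big_cons; exact: cintegrableD.
Qed.

(** Agreement is asked on [G] only, because the kernel symmetry is available only at points of
    [G]. *)
Lemma eq_cintegral f g : (forall x, G x -> f x = g x) ->
  cintegral G f = cintegral G g.
Proof.
by move=> fg; congr (_ +i* _)%C; apply: eq_Rintegral => x /set_mem /fg ->.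
Qed.

Lemma eq_cintegrable f g : (forall x, G x -> f x = g x) ->
  cintegrable G f -> cintegrable G g.
Proof.
move=> fg [fr fi]; split.
  by apply: eq_integrable fr => // x /set_mem /fg ->.
by apply: eq_integrable fi => // x /set_mem /fg ->.
Qed.

Lemma cintegralB f g : cintegrable G f -> cintegrable G g ->
  cintegral G (fun x => f x - g x) = cintegral G f - cintegral G g.
Proof.
move=> [fr fi] [gr gi]; rewrite /cintegral; apply/eqP; rewrite eq_complex /=.
rewrite -!RintegralB//; apply/andP; split; apply/eqP; apply: eq_Rintegral => x _.
  by case: (f x) (g x) => ? ? [].
by case: (f x) (g x) => ? ? [].
Qed.

Lemma cintegral_conj f : cintegrable G f ->
  cintegral G (fun x => conjc (f x)) = conjc (cintegral G f).
Proof.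
move=> [fr fi]; rewrite /cintegral /= -mulN1r -RintegralZl//.
congr (_ +i* _)%C; apply: eq_Rintegral => x _; case: (f x) => //= ? ?.
by rewrite mulN1r.
Qed.

Implicit Types u v w : R3 R -> HC R.

Lemma cintegrable_bqdot u v : bqL2 G u -> bqL2 G v ->
  cintegrable G (fun x => bqdot (u x) (v x)).
Proof.
move=> u2 v2; rewrite /bqdot; apply: cintegrable_sum => k.
exact: cintegrable_conjM.
Qed.

Lemma L2dotC u v : bqL2 G u -> bqL2 G v ->
  L2dot G u v = conjc (L2dot G v u).
Proof.
move=> u2 v2; rewrite /L2dot -cintegral_conj; last exact: cintegrable_bqdot.
apply: eq_cintegral => x _; rewrite /bqdot rmorph_sum/=; apply: eq_bigr => k _.
by rewrite rmorphM/= conjcK mulrC.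
Qed.

Lemma L2dotBr u v w : bqL2 G u -> bqL2 G v -> bqL2 G w ->
  L2dot G u (fun x => v x - w x) = L2dot G u v - L2dot G u w.
Proof.
move=> u2 v2 w2; rewrite /L2dot -cintegralB; [|exact: cintegrable_bqdot..].
apply: eq_cintegral => x _; rewrite /bqdot -sumrB; apply: eq_bigr => k _.
by rewrite !mxE mulrBr.
Qed.

End ComplexIntegral.

Section ReproducingKernel.
Context {R : realType}.
Variables (G : set (R3 R)) (A : @coefficients R).
Variable K : R3 R -> 'I_4 -> R3 R -> HC R.
Hypothesis mG : measurable (G : set (R3m R)).
Hypothesis hK : reproducing_kernel G A K.

Lemma reproducing_kernelC x t j k : G x -> G t ->
  K t j x 0 k = conjc (K x k t 0 j).
Proof.
move=> Gx Gt; have [Vx cx Kx] := hK k Gx; have [Vt ct Kt] := hK j Gt.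
(* The kernels are continuous, hence their own representatives, so the reproducing identity applies
   to them pointwise. *)
have rep w : bqcontinuous G w -> continuous_rep G w w.
  by move=> cw; split=> //; exact: aeW.
rewrite (Kx _ _ Vt (rep _ ct)) (Kt _ _ Vx (rep _ cx)).
by apply: L2dotC => //; [case: Vx|case: Vt].
Qed.

Lemma vekua_bergman_bqdot x t (a : HC R) k : G x -> G t ->
  vekua_bergman K x t a 0 k = bqdot (K x k t) a.
Proof.
move=> Gx Gt; rewrite /vekua_bergman summxE; apply: eq_bigr => j _.
by rewrite mxE (reproducing_kernelC _ _ Gx Gt) mulrC.
Qed.

End ReproducingKernel.

Theorem proposition19 (R : realType) (G : set (R3 R))
    (hG : liapunov_domain G)
    (A : @coefficients R) (hA : Linfty4 G A)
    (P : (R3 R -> HC R) -> (R3 R -> HC R))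
    (hP : orthogonal_projection G (vekua2 G A) P)
    (K : R3 R -> 'I_4 -> R3 R -> HC R)
    (hK : reproducing_kernel G A K)
    (u : R3 R -> HC R) (hu : bqL2 G u)
    (Pu : R3 R -> HC R) (hPu : continuous_rep G (P u) Pu)
    (x : R3 R) (hx : G x) :
  bqintegrable G (fun t => vekua_bergman K x t (u t)) /\
  Pu x = bqintegral G (fun t => vekua_bergman K x t (u t)).
Proof.
have mG : measurable (G : set (R3m R)).
  by have [[_ oG _] _ _ _] := hG; exact: measurable_open_R3.
have [VPu orthP] := hP u hu.
split=> [k|].
  have [[K2 _] _ _] := hK x k hx.
  (* In [K t j x] the function itself varies with [t], which hides measurability in [t]; by symmetry
     the integrand pairs the single L2 function [K x k] with [u]. *)
  apply: (eq_cintegrable mG) (cintegrable_bqdot mG K2 hu) => t Gt.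
  by rewrite (vekua_bergman_bqdot mG hK).
apply/rowP => k; rewrite mxE.
have [VK _ reprK] := hK x k hx.
rewrite (reprK _ _ VPu hPu).
have /eqP := orthP _ VK.
rewrite L2dotBr//; [|by case: VK|by case: VPu].
(* Orthogonality to [K x k] replaces [P u] by [u] in the inner product. *)
rewrite subr_eq0 => /eqP <-; apply: eq_cintegral => t Gt.
by rewrite (vekua_bergman_bqdot mG hK).
Qed.
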